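(* Let $p$ be an odd prime. Then there exists a Steiner triple system $\mathcal{S}$ of order $3p$, with underlying set $V$, such that $$|N(V')|\geq |V'|-3$$ for every subset $V'\subset V$ with $|V'|\leq \frac{|V|}{2}$.
   Context: A Steiner triple system of order $n$ consists of an $n$-element set $V$ and a collection $\mathcal{S}$ of 3-element subsets (triples) of $V$ such that every pair of distinct elements of $V$ is contained in exactly one triple. For $V'\subseteq V$, the neighbourhood $N(V')$ is the set of all $z\in V\setminus V'$ for which there exist distinct $x,y\in V'$ with $\{x,y,z\}\in\mathcal{S}$. *)

(* Defs.v *)
From mathcomp Require Import all_boot.

Set Implicit Arguments.
Unset Strict Implicit.
Unset Printing Implicit Defensive.

Definition steiner_triple_system (V : finType) (S : {set {set V}}) : Prop :=
  (forall T : {set V}, T \in S -> #|T| = 3) /\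
  (forall x y : V, x != y ->
     exists! T : {set V}, T \in S /\ [set x; y] \subset T).

Definition neighbourhood (V : finType) (S : {set {set V}}) (A : {set V}) :
    {set V} :=
  [set z in ~: A | [exists x in A, exists y in A,
                      (x != y) && ([set x; y; z] \in S)]].

(* Main.v *)
(* Bose's construction on Z_p x Z_3: the triples are the vertical ones
   {(x, 0), (x, 1), (x, 2)} and {(x, i), (y, i), ((x + y) / 2, i + 1)}, x <> y.
   Let A_i be the layers of A, and C_i those of the union of A and N(A). Then
   C_i contains 2 A_{i+1} - A_i, so Cauchy-Davenport gives
   |C_i| >= min(p, |A_i| + |A_{i+1}| - 1); if no layer is empty and no minimum is
   p, summing over i gives the bound. The other cases use the midpoints of A_i
   (all of Z_p as soon as |A_i| > (p + 1) / 2), which lie in C_{i+1}, and the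
   vertical triples. *)
Require Import Defs.
From mathcomp Require Import all_boot all_algebra zify.

Set Implicit Arguments.
Unset Strict Implicit.
Unset Printing Implicit Defensive.

(** * Arithmetic of the layer sizes *)

(** Since [a0 + a1] is at least [p + 2], one of [a0], [a1] exceeds [(p + 1) / 2], and its midpoints
    fill a second layer besides [c0]. If the third is not full as well, it is bounded by
    Cauchy-Davenport when [a2 > 0], and by [ac1] or [v2] when [a2 = 0]. *)
Lemma expansion_saturated (k p a0 a1 a2 c0 c1 c2 : nat) :
  p = k.*2.+1 -> 2 * (a0 + a1 + a2) <= 3 * p -> p + 2 <= a0 + a1 ->
  a0 <= p -> a1 <= p ->
  a1 <= c1 -> a2 <= c2 -> p <= c0 ->
  (0 < a1 -> 0 < a2 -> p <= c1 \/ a1 + a2 <= c1.+1) ->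
  (0 < a2 -> 0 < a0 -> p <= c2 \/ a2 + a0 <= c2.+1) ->
  (p + 2 <= 2 * a0 -> p <= c1) -> (p + 2 <= 2 * a1 -> p <= c2) ->
  (a0 <= c2 \/ a1 + a1 + a0 <= (c2 + p).+1) ->
  2 * (a0 + a1 + a2) <= c0 + c1 + c2 + 3.
Proof.
move=> -> hs sat a0p a1p ac1 ac2 pc0 h1 h2 m1 m2 v2.
have a1_gt0 : 0 < a1 by clear -sat a0p; lia.
have a0_gt0 : 0 < a0 by clear -sat a1p; lia.
have [big0|small0] := leqP (k.*2.+1 + 2) (2 * a0); last first.
  have {}m2: k.*2.+1 <= c2 by apply: m2; clear -sat small0; lia.
  have [a2_0|a2_gt0] := posnP a2.
    by clear -a2_0 m2 hs sat pc0 ac1 small0; lia.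
  by case: (h1 a1_gt0 a2_gt0) => {}h1; clear -h1 m2 hs sat pc0 small0; lia.
have {m1} pc1 := m1 big0.
have [big1|small1] := leqP (k.*2.+1 + 2) (2 * a1).
  by have := m2 big1; clear -hs pc0 pc1; lia.
have [a2_0|a2_gt0] := posnP a2.
  by case: v2 => v2; clear - v2 hs pc0 pc1 small1 a2_0 a0p; lia.
by case: (h2 a2_gt0 a0_gt0) => {}h2; clear - h2 hs pc0 pc1 small1; lia.
Qed.

(* [ai] is the size of layer [i] of a set, [ci] that of the union of this layer
   and of the corresponding layer of the neighbourhood. *)
Lemma expansion_arith (k p a0 a1 a2 c0 c1 c2 : nat) :
  p = k.*2.+1 -> 2 * (a0 + a1 + a2) <= 3 * p ->
  a0 <= p -> a1 <= p -> a2 <= p ->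
  a0 <= c0 -> a1 <= c1 -> a2 <= c2 ->
  (0 < a0 -> 0 < a1 -> p <= c0 \/ a0 + a1 <= c0.+1) ->
  (0 < a1 -> 0 < a2 -> p <= c1 \/ a1 + a2 <= c1.+1) ->
  (0 < a2 -> 0 < a0 -> p <= c2 \/ a2 + a0 <= c2.+1) ->
  a0 <= c1.+1 -> a1 <= c2.+1 -> a2 <= c0.+1 ->
  (p + 2 <= 2 * a0 -> p <= c1) ->
  (p + 2 <= 2 * a1 -> p <= c2) ->
  (p + 2 <= 2 * a2 -> p <= c0) ->
  (0 < a1 -> a0 <= c2 \/ a1 + a1 + a0 <= (c2 + p).+1) ->
  (0 < a2 -> a1 <= c0 \/ a2 + a2 + a1 <= (c0 + p).+1) ->
  (0 < a0 -> a2 <= c1 \/ a0 + a0 + a2 <= (c1 + p).+1) ->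
  2 * (a0 + a1 + a2) <= c0 + c1 + c2 + 3.
Proof.
move=> pE hs a0p a1p a2p ac0 ac1 ac2 h0 h1 h2 t1 t2 t0 m1 m2 m0 v2 v0 v1.
have pos (x y : nat) : x <= p -> p + 2 <= x + y -> 0 < y.
  by clear; lia.
have sat (x y c : nat) : p + 2 <= x + y -> p <= c \/ x + y <= c.+1 -> p <= c.
  by clear; lia.
have [s01|u01] := leqP (p + 2) (a0 + a1).
  have p1 : 0 < a1 by apply: pos s01.
  have p0 : 0 < a0 by apply: pos a1p _; rewrite (addnC a1).
  exact: (expansion_saturated pE hs s01 a0p a1p ac1 ac2
            (sat _ _ _ s01 (h0 p0 p1)) h1 h2 m1 m2 (v2 p1)).
(* The sums are rotated so that the next cyclic pair of layers comes first. *)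
rewrite (addnC (a0 + a1)) (addnC (c0 + c1)) !addnA in hs *.
have [s20|u20] := leqP (p + 2) (a2 + a0).
  have p0 : 0 < a0 by apply: pos s20.
  have p2 : 0 < a2 by apply: pos a0p _; rewrite (addnC a0).
  exact: (expansion_saturated pE hs s20 a2p a0p ac0 ac1
            (sat _ _ _ s20 (h2 p2 p0)) h0 h1 m0 m1 (v1 p0)).
rewrite (addnC (a2 + a0)) (addnC (c2 + c0)) !addnA in hs *.
have [s12|u12] := leqP (p + 2) (a1 + a2).
  have p2 : 0 < a2 by apply: pos s12.
  have p1 : 0 < a1 by apply: pos a2p _; rewrite (addnC a2).
  exact: (expansion_saturated pE hs s12 a1p a2p ac2 ac0
            (sat _ _ _ s12 (h1 p1 p2)) h2 h0 m2 m0 (v0 p2)).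
(* Below the threshold [p + 2], even a full layer satisfies the additive bound. *)
have unsat (x y c : nat) :
    x + y < p + 2 -> p <= c \/ x + y <= c.+1 -> x + y <= c.+1.
  by clear; lia.
have {}h0 p0 p1 := unsat _ _ _ u01 (h0 p0 p1).
have {}h1 p1 p2 := unsat _ _ _ u12 (h1 p1 p2).
have {}h2 p2 p0 := unsat _ _ _ u20 (h2 p2 p0).
clear -ac0 ac1 ac2 h0 h1 h2 t0 t1 t2.
(* With three nonempty layers the three Cauchy-Davenport bounds lose 1 each. With two, one such
   bound and two midpoint bounds again lose 3 in all. With one, the layer itself and its midpoints
   suffice. *)
case: (posnP a0) h0 h2 => [->|_] h0 h2; case: (posnP a1) h0 h1 => [->|_] h0 h1;
  case: (posnP a2) h1 h2 => [->|_] h1 h2.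
- by lia.
- by clear h0 h1 h2; lia.
- by clear h0 h1 h2; lia.
- by move/(_ erefl erefl): h1 => h1; clear h0 h2; lia.
- by clear h0 h1 h2; lia.
- by move/(_ erefl erefl): h2 => h2; clear h0 h1; lia.
- by move/(_ erefl erefl): h0 => h0; clear h1 h2; lia.
- move/(_ erefl erefl): h0; move/(_ erefl erefl): h1; move/(_ erefl erefl): h2.
  by clear; lia.
Qed.

(** * The Cauchy-Davenport theorem *)

Import GRing.Theory.
Local Open Scope ring_scope.

(** Adding [d] to [a] as many times as the natural number representing [(y - a) / d] reaches any
    [y]. *)
Lemma Fp_stable_setT (p : nat) (A : {set 'F_p}) (d : 'F_p) :
  A != set0 -> d != 0 -> (forall a, a \in A -> a + d \in A) -> A = setT.
Proof.
move=> /set0Pn [a aA] d0 Ad; apply/setP=> y; rewrite inE.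
have AdM (n : nat) : a + d *+ n \in A.
  by elim: n => [|n IHn]; rewrite ?mulr0n ?addr0 // mulrSr addrA Ad.
have := AdM ((y - a) / d : 'F_p).
by rewrite -mulr_natr natr_Zp mulrC divfK // addrC subrK => ->.
Qed.

(* Dyson's e-transform: for e in A - B, replace (A, B) by
   (A :|: (B + e), B :&: (A - e)); if no e shrinks B, then A is stable under the
   differences of elements of B. *)
Theorem cauchy_davenport (p : nat) (A B : {set 'F_p}) :
  prime p -> A != set0 -> B != set0 ->
  (minn p (#|A| + #|B|).-1 <= #|[set (a + b)%R | a in A, b in B]|)%N.
Proof.
move=> pr_p; have [n] := ubnP #|B|; elim: n => // n IHn in A B *.
rewrite ltnS => leBn A0 B0.
have [transform | stable] := boolP
  [exists a in A, exists b in B, exists c in B, c + (a - b) \notin A].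
  have [a aA] := exists_inP transform.
  move=> /exists_inP [b bB /exists_inP [c cB cNA]].
  set e := a - b in cNA.
  pose f x := x + e; have f_inj : injective f by exact: addIr.
  pose A' := A :|: f @: B; pose B' := B :&: f @^-1: A.
  have cardAB : (#|A'| + #|B'| = #|A| + #|B|)%N.
    rewrite -(card_imset B f_inj) -(card_imset B' f_inj).
    have -> : f @: B' = A :&: f @: B.
      apply/setP=> y; apply/imsetP/setIP => [[x /setIP[xB]] | [yA /imsetP[x xB yE]]].
        by rewrite inE => fxA ->; split; rewrite ?imset_f.
      by exists x; rewrite // !inE xB -yE.
    exact: cardsUI.
  (* For [z] in [B] and [y] in [B'], [(z + e) + y = (y + e) + z], where [y + e] lies in [A]. *)
  have subAB : [set x + y | x in A', y in B'] \subset [set x + y | x in A, y in B].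
    apply/subsetP => _ /imset2P[x y + /setIP[yB + ->]].
    move=> /setUP[xA _ | /imsetP[z zB ->]]; first by rewrite imset2_f.
    rewrite inE => fyA; apply/imset2P; exists (f y) z => //.
    by rewrite /f addrAC [RHS]addrAC (addrC y).
  apply: leq_trans (subset_leq_card subAB); rewrite -cardAB; apply: IHn.
  - apply: leq_trans leBn; apply: proper_card; apply/properP; split.
      exact: subsetIl.
    by exists c => //; rewrite !inE cB.
  - by apply/set0Pn; exists a; rewrite inE aA.
  - by apply/set0Pn; exists b; rewrite !inE bB /f /e addrC subrK.
have [b bB] := set0Pn _ B0.
have subA (x : 'F_p) : (#|[set (a + x)%R | a in A]| = #|A|)%N.
  exact: card_imset (addIr x).
have leA : (#|A| <= #|[set (a + b)%R | a in A, b in B]|)%N.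
  rewrite -(subA b); apply: subset_leq_card; apply/subsetP => _ /imsetP[x xA ->].
  exact: imset2_f.
have [->|neqB] := eqVneq B [set b].
  rewrite cards1 addn1 geq_min; apply/orP; right.
  rewrite -(subA b); apply: subset_leq_card; apply/subsetP => _ /imsetP[x xA ->].
  by rewrite imset2_f ?set11.
have [c cB cb] : exists2 c, c \in B & c != b.
  apply/exists_inP; apply: contraR neqB; rewrite negb_exists_in => /forall_inP Bb.
  rewrite eqEsubset sub1set bB andbT; apply/subsetP => x /Bb; rewrite inE negbK //.
have AT : A = setT.
  apply: (@Fp_stable_setT _ _ (c - b)) => // [|a aA]; first by rewrite subr_eq0.
  move: stable; rewrite negb_exists_in => /forall_inP/(_ a aA).
  rewrite negb_exists_in => /forall_inP/(_ b bB).
  rewrite negb_exists_in => /forall_inP/(_ c cB); rewrite negbK.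
  by rewrite addrCA.
by rewrite geq_min; apply/orP; left; move: leA; rewrite AT cardsT card_Fp.
Qed.

(** * Steiner triple systems from quasigroups *)

Section SteinerQuasigroup.
Variables (V : finType) (op : V -> V -> V).
Hypotheses (op_id : forall x, op x x = x) (opC : commutative op)
  (opK : forall x y, op x (op x y) = y).

Definition quasigroup_triples : {set {set V}} :=
  [set [set u.1; u.2; op u.1 u.2] | u in [pred u : V * V | u.1 != u.2]].

Lemma mem_quasigroup_triples x y :
  x != y -> [set x; y; op x y] \in quasigroup_triples.
Proof. by move=> xy; apply/imsetP; exists (x, y). Qed.

Lemma op_neql x y : x != y -> op x y != x.
Proof. by apply: contra => /eqP e; rewrite -(opK x y) e op_id. Qed.

Lemma op_neqr x y : x != y -> op x y != y.
Proof. by rewrite eq_sym opC => /op_neql. Qed.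

(** By [opC] and [opK], the product of any two points of [{u, v, op u v}] is the third, so any two
    of them determine the triple. *)
Lemma quasigroup_triples_steiner : steiner_triple_system quasigroup_triples.
Proof.
split=> [_ /imsetP[[x y] /[!inE] /= xy ->] | x y xy].
  rewrite setUC cardsU1 cards2 xy !inE negb_or.
  by rewrite (op_neql xy) (op_neqr xy).
exists [set x; y; op x y]; split=> [|T [/imsetP[[u v] _ ->] /=]].
  by rewrite mem_quasigroup_triples // subsetUl.
have opvK : op v (op u v) = u by rewrite (opC u) opK.
have opK' : op (op u v) u = v by rewrite opC opK.
have opvK' : op (op u v) v = u by rewrite opC opvK.
rewrite subUset !sub1set !inE.
move=> /andP[/orP[/orP[]|] /eqP xE /orP[/orP[]|] /eqP yE]; move: xy;
  rewrite {}xE {}yE ?eqxx // => _; rewrite ?opK ?opvK ?opK' ?opvK' ?(opC v u);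
  by apply/setP=> z; rewrite !inE; case: (z == u); case: (z == v); case: (z == op u v).
Qed.

(** The union with [A] absorbs the products that fall back into [A], among them [op x x = x]. *)
Lemma quasigroup_neighbourhood (A : {set V}) x y :
  x \in A -> y \in A ->
  op x y \in A :|: neighbourhood quasigroup_triples A.
Proof.
move=> xA yA; rewrite !inE; case: (boolP (op x y \in A)) => //= nA.
apply/exists_inP; exists x => //; apply/exists_inP; exists y => //.
have xy : x != y by apply: contra nA => /eqP ->; rewrite op_id.
by rewrite xy mem_quasigroup_triples.
Qed.
End SteinerQuasigroup.

(** * The Bose quasigroup *)

Section Bose.
Variable F : finFieldType.
Hypothesis two_neq0 : 2 != 0 :> F.

(** The third point of the triple through [u] and [v]. A vertical triple is completed by
    [- (i + j)], as the three layers sum to 0 modulo 3; the last two branches solve the midpoint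
    equation for the missing endpoint. *)
Definition bose_op (u v : F * 'I_3) : F * 'I_3 :=
  let: (x, i) := u in let: (y, j) := v in
  if i == j then if x == y then (x, i) else ((x + y) / 2, i + 1)
  else if x == y then (x, - (i + j))
  else if j == i + 1 then (2 * y - x, i) else (2 * x - y, j).

Lemma layerS_neq (i : 'I_3) : (i + 1 == i) = false.
Proof. by case: i => [[|[|[|//]]] ?]. Qed.

Lemma layer_third (i j : 'I_3) : (i == - (i + j)) = (i == j).
Proof. by case: i j => [[|[|[|//]]] ?] [[|[|[|//]]] ?]. Qed.

Lemma layer_next (i j : 'I_3) : i != j -> (j == i + 1) = (i != j + 1).
Proof. by case: i j => [[|[|[|//]]] ?] [[|[|[|//]]] ?]. Qed.

(** With [reflection_eq], this decides which branch a second application of [bose_op] takes. *)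
Lemma midpoint_eq (x y : F) : (x == (x + y) / 2) = (x == y).
Proof.
rewrite -(inj_eq (mulIf two_neq0)) divfK // mulr_natr mulr2n.
by rewrite (inj_eq (addrI x)).
Qed.

Lemma reflection_eq (x y : F) : (x == 2 * y - x) = (x == y).
Proof.
have -> : (x == 2 * y - x) = (2 * x == 2 * y).
  by rewrite [LHS]eq_sym subr_eq -mulr2n !mulr_natl eq_sym.
by rewrite (inj_eq (mulfI two_neq0)).
Qed.

Lemma bose_op_id u : bose_op u u = u.
Proof. by case: u => x i; rewrite /= !eqxx. Qed.

Lemma bose_opC : commutative bose_op.
Proof.
case=> x i [y j] /=; rewrite (eq_sym j i) (eq_sym y x) (addrC y x) (addrC j i).
have [->|ij] := eqVneq i j; first by case: eqP => // ->.
have [->//|xy] := eqVneq x y.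
by rewrite (layer_next ij); case: (i == _).
Qed.

(** Taking a midpoint and reflecting in a point of the next layer undo each other; vertical
    completion and reflection in [u] itself are involutions. *)
Lemma bose_opK u v : bose_op u (bose_op u v) = v.
Proof.
case: u v => x i [y j] /=.
have [<-|ij] := eqVneq i j.
  have [<-|xy] := eqVneq x y; first by rewrite /= !eqxx.
  rewrite /= eq_sym layerS_neq midpoint_eq (negPf xy) eqxx.
  by rewrite mulrCA divff // mulr1 addrAC subrr add0r.
have [<-|xy] := eqVneq x y.
  by rewrite /= layer_third (negPf ij) eqxx opprD opprK addrA addNr add0r.
have [->|jNi] := eqVneq j (i + 1).
  rewrite /= eqxx reflection_eq (negPf xy) addrCA subrr addr0.
  by rewrite mulrAC divff // mul1r.
have -> : (x == 2 * x - y) = (x == y).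
  by rewrite eq_sym mulr_natl mulr2n -addrA -subr_eq0 addrAC subrr add0r subr_eq0.
by rewrite /= (negPf ij) (negPf jNi) (negPf xy) opprB addrC subrK.
Qed.
End Bose.

(** * Expansion of the layers *)

(** Dilation by a nonzero scalar preserves cardinality. The minimum is split into the disjunction
    that [expansion_arith] expects. *)
Lemma cauchy_davenport_scale (p : nat) (s t : 'F_p) (A B C : {set 'F_p}) :
  prime p -> s != 0 -> t != 0 -> A != set0 -> B != set0 ->
  (forall a b, a \in A -> b \in B -> s * a + t * b \in C) ->
  (p <= #|C| \/ #|A| + #|B| <= #|C|.+1)%N.
Proof.
move=> pr_p s0 t0 A0 B0 sub_C.
have min_cases a b c : (minn p (a + b).-1 <= c -> p <= c \/ a + b <= c.+1)%N.
  by rewrite geq_min => /orP[|]; [left | right]; lia.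
apply: min_cases.
have := @cauchy_davenport p [set (s * a)%R | a in A] [set (t * b)%R | b in B].
rewrite !imset_eq0 !card_imset; [|exact: mulfI..].
move/(_ pr_p A0 B0)/leq_trans; apply; apply/subset_leq_card/subsetP.
by move=> _ /imset2P[_ _ /imsetP[a aA ->] /imsetP[b bB ->] ->]; apply: sub_C.
Qed.

Section Expansion.
Variables (p : nat) (A : {set 'F_p * 'I_3}).
Hypotheses (p_prime : prime p) (two_neq0 : 2 != 0 :> 'F_p).

Let C := A :|: neighbourhood (quasigroup_triples (@bose_op 'F_p)) A.

Definition layer (B : {set 'F_p * 'I_3}) (i : 'I_3) := [set x | (x, i) \in B].
Arguments layer B i%_R.

Lemma card_layers (B : {set 'F_p * 'I_3}) :
  (#|B| = #|layer B 0| + #|layer B 1| + #|layer B (1 + 1)|)%N.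
Proof.
have cardE i : (\sum_(u in B | u.2 == i) 1 = #|layer B i|)%N.
  rewrite sum1dep_card -[RHS](card_imset _ (_ : injective (fun x => (x, i)))).
    apply: eq_card => -[x j]; rewrite !inE /=; apply/andP/imsetP => [[xB /eqP <-]|].
      by exists x; rewrite ?inE.
    by move=> [y]; rewrite inE => yB [-> ->].
  by move=> x y [].
rewrite -sum1_card (partition_big snd xpredT) //= !big_ord_recl big_ord0 addn0.
rewrite !cardE addnA; congr (_ + #|layer _ _| + #|layer _ _|)%N; exact: val_inj.
Qed.

Lemma bose_mem u v : u \in A -> v \in A -> bose_op u v \in C.
Proof. by apply: quasigroup_neighbourhood; exact: bose_op_id. Qed.

Lemma layer_sub i : layer A i \subset layer C i.
Proof. by apply/subsetP=> x; rewrite !inE => ->. Qed.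

Lemma midpoint_mem i x y : x != y -> x \in layer A i -> y \in layer A i ->
  (x + y) / 2 \in layer C (i + 1).
Proof.
move=> xy; rewrite 2!inE => xA yA; have := bose_mem xA yA.
by rewrite /bose_op eqxx (negPf xy) [in X in _ -> X]inE.
Qed.

Lemma reflection_mem i x y : x \in layer A i -> y \in layer A (i + 1) ->
  2 * y - x \in layer C i.
Proof.
(* For [x = y] the reflection is [x] itself, which already lies in layer [i] of [A]. *)
have [->|xy] := eqVneq x y => xA yA.
  by rewrite mulr_natl mulr2n addrK (subsetP (layer_sub i)).
rewrite inE in xA; rewrite inE in yA; have := bose_mem xA yA.
by rewrite /bose_op eq_sym layerS_neq (negPf xy) eqxx [in X in _ -> X]inE.
Qed.

Lemma vertical_mem i x : x \in layer A i -> x \in layer A (i + 1) ->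
  x \in layer C (i + 1 + 1).
Proof.
rewrite 2!inE => xA yA; have := bose_mem xA yA.
rewrite /bose_op eq_sym layerS_neq eqxx [in X in _ -> X]inE.
suff -> : - (i + (i + 1)) = i + 1 + 1 by [].
by case: i {xA yA} => [[|[|[|//]]] ?]; exact: val_inj.
Qed.

Lemma card_layer_reflection i : (0 < #|layer A i| -> 0 < #|layer A (i + 1)|%N ->
  p <= #|layer C i| \/ #|layer A i| + #|layer A (i + 1)| <= #|layer C i|.+1)%N.
Proof.
rewrite !card_gt0 => A0 B0.
have m1 : -1 != 0 :> 'F_p by rewrite oppr_eq0 oner_neq0.
apply: (cauchy_davenport_scale p_prime m1 two_neq0 A0 B0) => x y xA yA.
by rewrite mulN1r addrC reflection_mem.
Qed.

(** The midpoints of a fixed [x] with the other points of its layer are distinct; only [y = x] is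
    lost. *)
Lemma card_layer_succ i : (#|layer A i| <= #|layer C (i + 1)|.+1)%N.
Proof.
have [->|/set0Pn[x xA]] := eqVneq (layer A i) set0; first by rewrite cards0.
rewrite (cardsD1 x) xA ltnS.
have f_inj : injective (fun y : 'F_p => (x + y) / 2).
  by move=> y z /(mulIf (invr_neq0 two_neq0)) /addrI.
rewrite -(card_imset _ f_inj); apply: subset_leq_card.
apply/subsetP => _ /imsetP[y /setD1P[yx yA] ->].
by rewrite midpoint_mem // eq_sym.
Qed.

(** If [z] is missed, the reflection of the layer in [z] meets the layer at most in [z], so twice
    the size of the layer is at most [p + 1]. *)
Lemma card_layer_full i : (p + 2 <= 2 * #|layer A i| ->
  p <= #|layer C (i + 1)|)%N.
Proof.
move=> big; suff -> : layer C (i + 1) = setT by rewrite cardsT card_Fp.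
apply/setP => z; rewrite [RHS]inE; apply: contraLR big => zC.
rewrite -ltnNge.
pose f x := 2 * z - x; pose L : {set 'F_p} := f @: layer A i.
have f_inj : injective f by move=> x y /addrI /oppr_inj.
have leI : (#|layer A i :&: L| <= 1)%N.
  rewrite -(cards1 z); apply/subset_leq_card/subsetP.
  move=> x /setIP[xA /imsetP[y yA xE]]; rewrite inE.
  apply: contraR zC => xz.
  have -> : z = (x + y) / 2 by rewrite xE subrK mulrC mulKf.
  apply: midpoint_mem => //; apply: contra xz => /eqP xy.
  by apply/eqP/(mulfI two_neq0); rewrite mulr_natl mulr2n {1}xE /f -xy subrK.
have leU : (#|layer A i :|: L| <= p)%N.
  by apply: leq_trans (max_card _) _; rewrite card_Fp.
have cardUI : (#|layer A i :|: L| + #|layer A i :&: L| = 2 * #|layer A i|)%N.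
  by rewrite cardsUI /L card_imset // mul2n addnn.
by clear -leI leU cardUI; lia.
Qed.

(* Where the layers [i] and [i + 1] overlap, the vertical triples supply the
   degenerate midpoints [(x + x) / 2], so that Cauchy-Davenport applies in place
   of its restricted version (Erdos-Heilbronn). *)
Lemma card_layer_vertical i : (0 < #|layer A (i + 1)|%N ->
  #|layer A i| <= #|layer C (i + 1 + 1)| \/
  #|layer A (i + 1)| + #|layer A (i + 1)| + #|layer A i|
     <= (#|layer C (i + 1 + 1)| + p).+1)%N.
Proof.
rewrite card_gt0 => B0.
have h0 : 2^-1 != 0 :> 'F_p by rewrite invr_eq0.
(* A degenerate midpoint [x] enters [D] either through a vertical triple or because it lies outside
   [layer A i]. The bound [leD] turns the two Cauchy-Davenport alternatives for [D] into the two of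
   the conclusion. *)
pose D := layer C (i + 1 + 1) :|: ~: layer A i.
have leD : (#|D| <= #|layer C (i + 1 + 1)| + (p - #|layer A i|))%N.
  by apply: leq_trans (leq_card_setU _ _) _; rewrite leq_add2l (cardsCs (~: _)) setCK card_Fp.
have leA : (#|layer A i| <= p)%N by have := max_card (layer A i); rewrite card_Fp.
suff : (p <= #|D| \/ #|layer A (i + 1)| + #|layer A (i + 1)| <= #|D|.+1)%N.
  by clear -leA leD; lia.
apply: (cauchy_davenport_scale p_prime h0 h0 B0 B0) => x y xA yA.
rewrite -mulrDr mulrC !in_setU in_setC.
have [<-|xy] := eqVneq x y; last by rewrite midpoint_mem.
rewrite -mulr2n -(mulr_natr x) mulfK //.
by case: (boolP (x \in layer A i)) => [xAi|_]; rewrite ?orbT // vertical_mem.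
Qed.

Lemma bose_expansion : odd p -> (2 * #|A| <= 3 * p)%N ->
  (#|A| - 3 <= #|neighbourhood (quasigroup_triples (@bose_op 'F_p)) A|)%N.
Proof.
move=> p_odd leA.
have cardC : #|C| = (#|A| + #|neighbourhood (quasigroup_triples (@bose_op 'F_p)) A|)%N.
  rewrite cardsU (_ : A :&: _ = set0) ?cards0 ?subn0 //.
  by apply/setP => x; rewrite !inE; case: (x \in A).
(* As [C] is a disjoint union, [A] is counted once in [C] and once in the bound sought. *)
suff : (2 * #|A| <= #|C| + 3)%N by lia.
have lep i : (#|layer A i| <= p)%N.
  by have := max_card (layer A i); rewrite card_Fp.
have leC i := subset_leq_card (layer_sub i).
have pE : p = p./2.*2.+1 by rewrite -[LHS]odd_double_half p_odd.
have I3 : 1 + 1 + 1 = 0 :> 'I_3 by exact: val_inj.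
have I1 : 0 + 1 = 1 :> 'I_3 by exact: val_inj.
rewrite (card_layers A) (card_layers C); rewrite (card_layers A) in leA.
have := @card_layer_reflection 0; have := @card_layer_reflection 1.
have := @card_layer_reflection (1 + 1).
have := @card_layer_succ 0; have := @card_layer_succ 1.
have := @card_layer_succ (1 + 1).
have := @card_layer_full 0; have := @card_layer_full 1.
have := @card_layer_full (1 + 1).
have := @card_layer_vertical 0; have := @card_layer_vertical 1.
have := @card_layer_vertical (1 + 1).
rewrite !I3 !I1 => v1 v0 v2 m0 m2 m1 t0 t2 t1 r2 r1 r0.
exact: (expansion_arith pE leA (lep _) (lep _) (lep _) (leC _) (leC _) (leC _)
          r0 r1 r2 t1 t2 t0 m1 m2 m0 v2 v0 v1).
Qed.
End Expansion.

Local Close Scope ring_scope.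

Theorem theorem1 (p : nat) (p_prime : prime p) (p_odd : odd p) :
  exists (V : finType) (S : {set {set V}}),
    [/\ #|V| = 3 * p,
        steiner_triple_system S
      & forall A : {set V}, 2 * #|A| <= #|V| ->
          #|neighbourhood S A| >= #|A| - 3].
Proof.
have two_neq0 : (2 != 0 :> 'F_p)%R.
  rewrite -(dvdn_pcharf (pchar_Fp p_prime)).
  by apply: contraL p_odd; rewrite dvdn_prime2 // => /eqP ->.
have cardV : #|{: 'F_p * 'I_3}| = 3 * p.
  by rewrite card_prod card_Fp // card_ord mulnC.
exists ('F_p * 'I_3)%type, (quasigroup_triples (@bose_op 'F_p)); split=> //.
  apply: quasigroup_triples_steiner.
  - exact: bose_op_id.
  - exact: bose_opC.
  - exact: bose_opK.
by move=> A; rewrite cardV; apply: bose_expansion.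
Qed.
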